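(* Let $0\le\ell<u$, $n\ge2$ and $p>2$. There exists a unique $\boldsymbol\xi^*=(\ell,\xi^*_1,\ldots,\xi^*_{n-1},u)$ with $\ell<\xi_1^*<\cdots<\xi_{n-1}^*<u$ such that $F(\boldsymbol\xi^* )=0$.
   Context: For $\boldsymbol\xi=(\xi_0,\ldots,\xi_n)$ with $\ell=\xi_0<\xi_1<\cdots<\xi_{n-1}<\xi_n=u$, $F(\boldsymbol\xi):=[F_1(\boldsymbol\xi),\ldots,F_{n-1}(\boldsymbol\xi)]^\top$ where, for $i=1,\ldots,n-1$, $$F_i(\boldsymbol\xi):=-\frac{\xi_i^p+(p-1)\xi_{i+1}^p-p\,\xi_i\xi_{i+1}^{p-1}}{\xi_{i+1}^{p-1}-\xi_i^{p-1}}+\frac{\xi_i^p+(p-1)\xi_{i-1}^p-p\,\xi_i\xi_{i-1}^{p-1}}{\xi_i^{p-1}-\xi_{i-1}^{p-1}}.$$ *)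

(* Defs.v *)
From mathcomp Require Import all_boot all_order all_algebra.
From mathcomp Require Import all_classical all_reals all_analysis.
Set Implicit Arguments.
Unset Strict Implicit.
Unset Printing Implicit Defensive.
Import Order.TTheory GRing.Theory Num.Theory.
Local Open Scope ring_scope.

(* [powR] satisfies [0 `^ q = 0] for [q != 0], the usual convention, which
   matters when the left endpoint is 0. *)
Definition tangent_gap (R : realType) (p x y : R) : R :=
  x `^ p + (p - 1) * y `^ p - p * x * y `^ (p - 1).

(* For the indices used in [F] below, [k <= n], so that [inord] is exact. *)
Definition knot (R : realType) (n : nat) (xi : 'rV[R]_n.+1) (k : nat) : R :=
  xi 0 (inord k).

Definition Fcomp (R : realType) (n : nat) (p : R) (xi : 'rV[R]_n.+1)
    (i : nat) : R :=
  - (tangent_gap p (knot xi i) (knot xi i.+1)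
       / (knot xi i.+1 `^ (p - 1) - knot xi i `^ (p - 1)))
  + tangent_gap p (knot xi i) (knot xi i.-1)
       / (knot xi i `^ (p - 1) - knot xi i.-1 `^ (p - 1)).

(* Row [j] of the column is the component of index [j + 1]: the components are
   indexed by the interior knots 1, ..., n - 1. *)
Definition F (R : realType) (n : nat) (p : R) (xi : 'rV[R]_n.+1) :
    'cV[R]_(n.-1) :=
  \col_(j < n.-1) Fcomp p xi j.+1.

Definition is_grid (R : realType) (n : nat) (l u : R) (xi : 'rV[R]_n.+1) :
    Prop :=
  [/\ xi 0 ord0 = l, xi 0 ord_max = u &
      forall i j : 'I_n.+1, (i < j)%N -> xi 0 i < xi 0 j].

(* Main.v *)
Require Import Defs.
From mathcomp Require Import all_boot all_order all_algebra.
From mathcomp Require Import all_classical all_reals all_analysis.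
From mathcomp Require Import zify ring lra.
Import Order.TTheory GRing.Theory Num.Theory.
Local Open Scope ring_scope.

(** Write [M x y] for the abscissa at which the tangents to [t |-> t `^ p] at
    [x] and [y] meet.  The two quotients in [Fcomp p xi i] are
    [p * (M xi_i xi_(i+1) - xi_i)] and [p * (xi_i - M xi_(i-1) xi_i)], so
    [F p xi = 0] says that every interior knot is the midpoint of the two
    neighbouring meeting points:
      [2 xi_i = M xi_(i-1) xi_i + M xi_i xi_(i+1)]   (a balanced sequence).
    Strict convexity of the power function makes [M] a strict mean
    ([tangent_meet_gt], [tangent_meet_lt]) that is strictly increasing in each
    argument ([lt_tangent_meetl], [lt_tangent_meetr]); [M] is also homogeneous
    of degree 1 ([tangent_meetZ]).

    Existence is a Knaster-Tarski argument
    ([exists_balanced_nondecreasing]).  As [M] is nondecreasing, replacing each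
    interior knot by the midpoint above, and the end knots by [l] and [u], is a
    monotone operation on the complete lattice of nondecreasing sequences with
    values between [l] and [u], so it has a fixed point.  If two neighbouring
    knots of it coincide, then, [M] being a strict mean, so do the next ones on
    both sides, and hence all the knots, against [l < u]: the fixed point is a
    strict grid ([balanced_incr]).

    Uniqueness ([balanced_eq]) uses homogeneity.  Given [xi_(i-1)] and
    [xi_i], the balance equation determines the ratio [xi_(i+1) / xi_i] as an
    increasing function of [xi_i / xi_(i-1)].  Hence, of two solutions, the one
    with the larger first interior knot has the larger ratios throughout; as
    both end at [u], they agree, going back from the last knot. *)

(** * The tangent gap and the meeting point of two tangents *)

Section TangentMeet.
Variables (R : realType) (p : R).
Hypothesis p_gt1 : 1 < p.

Let p_gt0 : 0 < p. Proof. exact: lt_trans ltr01 p_gt1. Qed.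
Let pB1_gt0 : 0 < p - 1. Proof. by rewrite subr_gt0. Qed.

(** Weighted AM-GM: [x `^ p] and [y `^ p] with weights [1 / p] and
    [1 - 1 / p] have geometric mean [x * y `^ (p - 1)].  It follows from
    [1 + t < expR t], applied around the exponent of the geometric mean. *)
Lemma tangent_gap_gt0 (x y : R) :
  0 <= x -> 0 <= y -> x != y -> 0 < tangent_gap p x y.
Proof.
move=> x0 y0 xy; rewrite /tangent_gap.
have [y_eq0|yN0] := eqVneq y 0.
  rewrite y_eq0 !powR0 ?gt_eqF// !mulr0 addr0 subr0 powR_gt0//.
  by rewrite lt_def x0 andbT -y_eq0.
have ygt0 : 0 < y by rewrite lt_def yN0.
have [x_eq0|xN0] := eqVneq x 0.
  rewrite x_eq0 powR0 ?gt_eqF// mulr0 mul0r subr0 add0r.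
  by rewrite mulr_gt0 ?powR_gt0.
have xgt0 : 0 < x by rewrite lt_def xN0.
rewrite /powR (negbTE xN0) (negbTE yN0).
have -> : x = expR (ln x) by rewrite lnK.
rewrite expRK; set a := ln x; set b := ln y.
have ab : a != b by apply: contra_neq xy; apply: ln_inj.
rewrite -mulrA -expRD; set m := a + (p - 1) * b.
have hexp t : t != 0 -> expR m * (1 + t) < expR (m + t).
  by move=> t0; rewrite expRD ltr_pM2l ?expR_gt0// expR_gt1Dx.
have /hexp : (p - 1) * (a - b) != 0 by rewrite mulf_neq0 ?(gt_eqF pB1_gt0) ?subr_eq0.
have /hexp : b - a != 0 by rewrite subr_eq0 eq_sym.
rewrite -(ltr_pM2l pB1_gt0).
have -> : m + (b - a) = p * b by rewrite /m; ring.
have -> : m + (p - 1) * (a - b) = p * a by rewrite /m; ring.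
move=> hb ha; rewrite subr_gt0; apply: le_lt_trans (ltrD ha hb).
by rewrite le_eqVlt; apply/orP; left; apply/eqP; ring.
Qed.

(** For [x != y] this is the abscissa where the tangents to [t |-> t `^ p] at
    [x] and [y] meet; the diagonal gets its limit, which makes the function
    monotone on nondecreasing pairs. *)
Definition tangent_meet (x y : R) : R :=
  if x == y then x
  else (p - 1) / p * (y `^ p - x `^ p) / (y `^ (p - 1) - x `^ (p - 1)).

Lemma tangent_meet_diag (x : R) : tangent_meet x x = x.
Proof. by rewrite /tangent_meet eqxx. Qed.

Lemma powRB1_lt (x y : R) : 0 <= x -> x < y -> x `^ (p - 1) < y `^ (p - 1).
Proof. by move=> x0 xy; rewrite gt0_ltr_powR ?nnegrE// (le_trans x0)// ltW. Qed.

Lemma tangent_meetM (x y : R) : 0 <= x -> x < y ->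
  p * (tangent_meet x y * (y `^ (p - 1) - x `^ (p - 1)))
    = (p - 1) * (y `^ p - x `^ p).
Proof.
move=> x0 xy; rewrite /tangent_meet lt_eqF// mulfVK; last first.
  by rewrite gt_eqF// subr_gt0 powRB1_lt.
by field; rewrite gt_eqF.
Qed.

Lemma tangent_gap_divl (x y : R) : 0 <= x -> x < y ->
  tangent_gap p x y / (y `^ (p - 1) - x `^ (p - 1)) = p * (tangent_meet x y - x).
Proof.
move=> x0 xy; apply: canLR (mulfK _) _.
  by rewrite gt_eqF// subr_gt0 powRB1_lt.
rewrite -mulrA mulrBl mulrBr tangent_meetM// /tangent_gap.
by rewrite -(@mulr_powRB1 _ x)//; ring.
Qed.

Lemma tangent_gap_divr (x y : R) : 0 <= x -> x < y ->
  tangent_gap p y x / (y `^ (p - 1) - x `^ (p - 1)) = p * (y - tangent_meet x y).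
Proof.
move=> x0 xy; apply: canLR (mulfK _) _.
  by rewrite gt_eqF// subr_gt0 powRB1_lt.
rewrite -mulrA mulrBl mulrBr tangent_meetM// /tangent_gap.
by rewrite -(@mulr_powRB1 _ y)// ?(le_trans x0 (ltW xy))//; ring.
Qed.

Lemma tangent_meet_gt (x y : R) : 0 <= x -> x < y -> x < tangent_meet x y.
Proof.
move=> x0 xy; rewrite -subr_gt0 -(pmulr_rgt0 _ p_gt0) -tangent_gap_divl//.
apply: divr_gt0; last by rewrite subr_gt0 powRB1_lt.
by rewrite tangent_gap_gt0 ?lt_eqF// (le_trans x0)// ltW.
Qed.

Lemma tangent_meet_lt (x y : R) : 0 <= x -> x < y -> tangent_meet x y < y.
Proof.
move=> x0 xy; rewrite -subr_gt0 -(pmulr_rgt0 _ p_gt0) -tangent_gap_divr//.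
apply: divr_gt0; last by rewrite subr_gt0 powRB1_lt.
by rewrite tangent_gap_gt0 ?gt_eqF// (le_trans x0)// ltW.
Qed.

(** Up to the factor [(p - 1) / p], the meeting point is the slope of a chord
    of [y `^ p] as a function of [y `^ (p - 1)], so the meeting point over
    [x < z] is a weighted mean of those over [x < y] and [y < z]; the latter two
    are separated by [y]. *)
Lemma tangent_meet_chord (x y z : R) : 0 <= x -> x < y -> y < z ->
  tangent_meet x y < tangent_meet x z < tangent_meet y z.
Proof.
move=> x0 xy yz; have y0 := le_trans x0 (ltW xy); have xz := lt_trans xy yz.
have XY := powRB1_lt _ _ x0 xy; have YZ := powRB1_lt _ _ y0 yz.
have My := lt_trans (tangent_meet_lt _ _ x0 xy) (tangent_meet_gt _ _ y0 yz).
have : tangent_meet x z * (z `^ (p - 1) - x `^ (p - 1)) =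
    tangent_meet x y * (y `^ (p - 1) - x `^ (p - 1)) +
    tangent_meet y z * (z `^ (p - 1) - y `^ (p - 1)).
  apply: (mulfI (lt0r_neq0 p_gt0)); rewrite [RHS]mulrDr !tangent_meetM//; ring.
move: My XY YZ.
move: (tangent_meet x y) (tangent_meet x z) (tangent_meet y z).
move: (x `^ _) (y `^ _) (z `^ _) => X Y Z Mxy Mxz Myz Mlt XY YZ E.
by apply/andP; split; nra.
Qed.

Lemma lt_tangent_meetr (x y z : R) : 0 <= x -> x <= y -> y < z ->
  tangent_meet x y < tangent_meet x z.
Proof.
move=> x0; rewrite le_eqVlt => /predU1P[<- xz|xy yz].
  by rewrite tangent_meet_diag tangent_meet_gt.
by case/andP: (tangent_meet_chord _ _ _ x0 xy yz).
Qed.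

Lemma lt_tangent_meetl (x y z : R) : 0 <= x -> x < y -> y <= z ->
  tangent_meet x z < tangent_meet y z.
Proof.
move=> x0 xy; rewrite le_eqVlt => /predU1P[<-|yz].
  by rewrite tangent_meet_diag tangent_meet_lt.
by case/andP: (tangent_meet_chord _ _ _ x0 xy yz).
Qed.

Lemma le_tangent_meet (x x' y y' : R) :
  0 <= x -> x <= y -> x' <= y' -> x <= x' -> y <= y' ->
  tangent_meet x y <= tangent_meet x' y'.
Proof.
move=> x0 xy xy' xx' yy'; apply: (@le_trans _ _ (tangent_meet x y')).
  move: yy'; rewrite le_eqVlt => /predU1P[->//|yy'].
  exact/ltW/lt_tangent_meetr.
move: xx'; rewrite le_eqVlt => /predU1P[->//|xx'].
exact/ltW/lt_tangent_meetl.
Qed.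

Lemma tangent_meet_ge (x y : R) : 0 <= x -> x <= y -> x <= tangent_meet x y.
Proof.
by move=> x0 xy; rewrite -{1}(tangent_meet_diag x) le_tangent_meet.
Qed.

Lemma tangent_meet_le (x y : R) : 0 <= x -> x <= y -> tangent_meet x y <= y.
Proof.
by move=> x0 xy; rewrite -{2}(tangent_meet_diag y) le_tangent_meet.
Qed.

Lemma tangent_meetZ (c x y : R) : 0 < c -> 0 <= x -> 0 <= y ->
  tangent_meet (c * x) (c * y) = c * tangent_meet x y.
Proof.
move=> c0 x0 y0; rewrite /tangent_meet (inj_eq (mulfI (lt0r_neq0 c0))).
case: eqVneq => // xy; rewrite !(powRM _ (ltW c0))// -!mulrBr.
rewrite -(@mulr_powRB1 _ c)// ?ltW//.
have := powR_gt0 (p - 1) c0; move: (c `^ _) => C C0.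
rewrite invfM; move: (y `^ (p - 1) - x `^ (p - 1))^-1 => E.
by field; rewrite !gt_eqF.
Qed.

(** * Uniqueness of balanced sequences *)

Definition balanced (n : nat) (x : nat -> R) : Prop :=
  forall i, (i.+1 < n)%N ->
    tangent_meet (x i) (x i.+1) + tangent_meet (x i.+1) (x i.+2) = 2 * x i.+1.

Lemma incr_sequence_gt0 (n : nat) (x : nat -> R) : 0 <= x 0%N ->
  (forall i, (i < n)%N -> x i < x i.+1) -> forall i, (i < n)%N -> 0 < x i.+1.
Proof.
move=> x0 xS; elim=> [|i IH] lt_in; first exact: le_lt_trans (xS _ lt_in).
exact: lt_trans (IH (ltnW lt_in)) (xS _ lt_in).
Qed.

(** Multiplying the balance equation of [x] by [y i.+1] and that of [y] by
    [x i.+1] gives both the same right-hand side.  A smaller ratio for [x] at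
    [i] makes the first of its rescaled meeting points the larger, hence the
    second one the smaller, and with it the ratio at [i.+1].  The ratios are cross-multiplied because
    [x 0] may vanish. *)
Lemma balanced_ratio_le (n : nat) (x y : nat -> R) :
  0 <= x 0%N -> 0 <= y 0%N ->
  (forall i, (i < n)%N -> x i < x i.+1) ->
  (forall i, (i < n)%N -> y i < y i.+1) ->
  balanced n x -> balanced n y ->
  x 1%N * y 0%N <= y 1%N * x 0%N ->
  forall i, (i < n)%N -> x i.+1 * y i <= y i.+1 * x i.
Proof.
move=> x0 y0 xS yS bx bY xy1; elim=> [//|i IH] lt_in.
have lt_i := ltnW lt_in; have {IH} := IH lt_i.
have xpos := incr_sequence_gt0 _ _ x0 xS; have ypos := incr_sequence_gt0 _ _ y0 yS.
have x_i : 0 <= x i by case: (i) lt_i => // j /ltnW/xpos/ltW.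
have y_i : 0 <= y i by case: (i) lt_i => // j /ltnW/ypos/ltW.
have x1 := xpos _ lt_i; have y1 := ypos _ lt_i.
have x2 := xpos _ lt_in; have y2 := ypos _ lt_in.
have := bx _ lt_in; have := bY _ lt_in.
have := xS _ lt_i; have := yS _ lt_i; have := xS _ lt_in; have := yS _ lt_in.
clear lt_in lt_i xpos ypos x0 y0 xS yS bx bY xy1.
move: (x i) (x i.+1) (x i.+2) (y i) (y i.+1) (y i.+2) x_i y_i x1 y1 x2 y2.
move=> x0 x1 x2 y0 y1 y2 hx0 hy0 hx1 hy1 hx2 hy2 ly12 lx12 ly01 lx01 ey ex r01.
rewrite leNgt; apply/negP => r12.
have h1 : tangent_meet (x1 * y0) (x1 * y1) <= tangent_meet (y1 * x0) (y1 * x1).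
  by apply: le_tangent_meet; rewrite ?ler_pM2l ?mulr_ge0// ?[y1 * x1]mulrC// ltW.
have h2 : tangent_meet (x1 * y1) (x1 * y2) < tangent_meet (y1 * x1) (y1 * x2).
  rewrite [y1 * x1]mulrC; apply: lt_tangent_meetr.
  - by rewrite mulr_ge0// ltW.
  - by rewrite ler_pM2l// ltW.
  - by rewrite mulrC [y1 * _]mulrC.
have [x1_ge0 y1_ge0] := (ltW hx1, ltW hy1).
move: h1 h2; rewrite !tangent_meetZ// ?(ltW hx2) ?(ltW hy2)//.
move=> h1 h2; have := ler_ltD h1 h2.
by rewrite -!mulrDr ex ey mulrCA [y1 * _]mulrCA [y1 * _]mulrC ltxx.
Qed.

Lemma balanced_eq (n : nat) (l u : R) (x y : nat -> R) :
  0 <= l -> x 0%N = l -> y 0%N = l -> x n = u -> y n = u ->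
  (forall i, (i < n)%N -> x i < x i.+1) ->
  (forall i, (i < n)%N -> y i < y i.+1) ->
  balanced n x -> balanced n y ->
  forall i, (i <= n)%N -> x i = y i.
Proof.
move=> l0.
(* The ratios of [y] dominate those of [x]: from the common first term this
   gives [x <= y], from the common last term it gives [y <= x]. *)
wlog xy1 : x y / x 1%N <= y 1%N.
  move=> H x0 y0 xn yn xS yS bx bY i lein.
  have [xy1|/ltW yx1] := leP (x 1%N) (y 1%N); first exact: H.
  by apply/esym/H.
move=> x0 y0 xn yn xS yS bx bY.
have x0_ge0 : 0 <= x 0%N by rewrite x0.
have y0_ge0 : 0 <= y 0%N by rewrite y0.
have ratio : forall i, (i < n)%N -> x i.+1 * y i <= y i.+1 * x i.
  by apply: balanced_ratio_le => //; rewrite x0 y0 ler_wpM2r.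
have xpos := incr_sequence_gt0 _ _ x0_ge0 xS.
have ypos := incr_sequence_gt0 _ _ y0_ge0 yS.
have le_xy i : (i <= n)%N -> x i <= y i.
  elim: i => [|[|i] IH] lt_in; [by rewrite x0 y0|by []|].
  have yi := ypos _ (ltnW lt_in).
  rewrite -(ler_pM2r yi) (le_trans (ratio _ lt_in))// ler_pM2l ?ypos//.
  exact/IH/ltnW.
have le_yx j : (j <= n)%N -> y (n - j)%N <= x (n - j)%N.
  elim: j => [|j IH] lt_jn; first by rewrite subn0 xn yn.
  have {IH} := IH (ltnW lt_jn).
  have lt_n : (n - j.+1 < n)%N by lia.
  have -> : (n - j = (n - j.+1).+1)%N by lia.
  move: (n - j.+1)%N lt_n => i lt_in yx.
  rewrite -(ler_pM2l (xpos _ lt_in)) (le_trans (ratio _ lt_in))//.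
  rewrite ler_wpM2r//.
  by case: (i) lt_in => [|k /ltnW/xpos/ltW].
move=> i le_in; apply/eqP; rewrite eq_le le_xy//=.
by rewrite -(subKn le_in) le_yx// leq_subr.
Qed.

(** * Existence of balanced sequences *)

(** Knaster-Tarski for the midpoint operation on nondecreasing sequences: the
    pointwise supremum of the sequences that lie below their image is a fixed
    point. *)
Lemma exists_balanced_nondecreasing (n : nat) (l u : R) :
  (0 < n)%N -> 0 <= l -> l < u ->
  exists x : nat -> R, [/\ forall i, x i <= x i.+1, x 0%N = l, x n = u
    & balanced n x].
Proof.
move=> n0 l0 lu.
pose T (v : nat -> R) i : R :=
  if i == 0%N then l else if (i < n)%N then
    (tangent_meet (v i.-1) (v i) + tangent_meet (v i) (v i.+1)) / 2
  else u.
pose mono (v : nat -> R) :=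
  (forall i, v i <= v i.+1) /\ (forall i, l <= v i <= u).
have Tmono v : mono v -> mono (T v).
  move=> [vS vlu].
  have v0 i : 0 <= v i by case/andP: (vlu i) => /(le_trans l0).
  have mlu i : l <= tangent_meet (v i) (v i.+1) <= u.
    have /andP[li _] := vlu i; have /andP[_ iu] := vlu i.+1.
    by rewrite (le_trans li) ?tangent_meet_ge// (le_trans _ iu)// tangent_meet_le.
  have mS i : tangent_meet (v i) (v i.+1) <= tangent_meet (v i.+1) (v i.+2).
    exact: le_tangent_meet.
  split=> [] [|i]; rewrite /T /=.
  - case: ifP => _; last exact: ltW.
    by have := mlu 0%N; have := mlu 1%N; lra.
  - case: ifP => lt_in; last by rewrite ifF//; apply/negP => /ltnW; rewrite lt_in.
    have := mlu i; have := mlu i.+1; have := mS i; have := mS i.+1.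
    by case: ifP => _; lra.
  - by rewrite lexx ltW.
  - by have := mlu i; have := mlu i.+1; case: ifP => _; lra.
have Tle v w : mono v -> mono w -> (forall i, v i <= w i) ->
    forall i, T v i <= T w i.
  move=> [vS vlu] [wS wlu] vw [|i]; rewrite /T//=; case: ifP => // _.
  have v0 j : 0 <= v j by case/andP: (vlu j) => /(le_trans l0).
  by rewrite ler_pM2r ?invr_gt0// lerD// le_tangent_meet.
pose V := [set v | mono v /\ forall i, v i <= T v i]%classic.
pose x i := sup [set v i | v in V]%classic.
have V0 : V (fun=> l).
  have m0 : mono (fun=> l) by split=> i //; rewrite lexx ltW.
  by split=> // i; have [_ /(_ i)/andP[]] := Tmono _ m0.
have ub i : has_ubound [set v i | v in V]%classic.
  by exists u => _ [v [[_ /(_ i)/andP[_ ?]] _] <-].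
have Vx v i : V v -> v i <= x i by move=> Vv; apply: ub_le_sup => //; exists v.
have xle i c : (forall v, V v -> v i <= c) -> x i <= c.
  move=> vc; apply: ge_sup; first by exists l, (fun=> l).
  by move=> _ [v /vc ? <-].
have xmono : mono x.
  split=> i.
    by apply: xle => v Vv; apply: le_trans (Vx _ _ Vv); case: Vv => -[].
  rewrite (Vx _ i V0) /=; apply: xle => v [[_ /(_ i)/andP[]]] //.
have xT i : x i <= T x i.
  apply: xle => v Vv; have [mv /(_ i)/le_trans vT] := Vv.
  by apply/vT/Tle => // j; apply: Vx.
have Tx i : T x i = x i.
  apply/eqP; rewrite eq_le xT andbT; apply: Vx; split; first exact: Tmono.
  by apply: Tle => //; apply: Tmono.
exists x; split; [by case: xmono|by rewrite -Tx| |].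
  by rewrite -Tx /T ltnn -leqn0 leqNgt n0.
by move=> i lt_in; rewrite -[in RHS]Tx /T /= lt_in mulrC divfK// pnatr_eq0.
Qed.

(** As the meeting point is a strict mean, a balanced nondecreasing sequence
    with two equal neighbours is constant. *)
Lemma balanced_incr (n : nat) (x : nat -> R) :
  0 <= x 0%N -> x 0%N < x n -> (forall i, x i <= x i.+1) -> balanced n x ->
  forall i, (i < n)%N -> x i < x i.+1.
Proof.
move=> x0 x0n xS bx.
have xge0 i : 0 <= x i by elim: i => // i /le_trans; apply.
have eqS i : (i.+1 < n)%N -> (x i == x i.+1) = (x i.+1 == x i.+2).
  move=> /bx.
  have [e1|n1] := eqVneq (x i); have [e2|n2] := eqVneq (x i.+1) => //.
    have lt2 : x i.+1 < x i.+2 by rewrite lt_neqAle n2 xS.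
    by rewrite e1 tangent_meet_diag; have := tangent_meet_gt _ _ (xge0 _) lt2; lra.
  have lt1 : x i < x i.+1 by rewrite lt_neqAle n1 xS.
  by rewrite -e2 tangent_meet_diag; have := tangent_meet_lt _ _ (xge0 _) lt1; lra.
have eq0 i : (i < n)%N -> (x i == x i.+1) = (x 0%N == x 1%N).
  by elim: i => // i IH lt_in; rewrite -eqS// IH// ltnW.
move=> i lt_in; rewrite lt_neqAle xS andbT eq0//; apply/negP => e01.
suff x0E j : (j <= n)%N -> x j = x 0%N by move: x0n; rewrite x0E// ltxx.
elim: j => // j IH lt_jn; rewrite -IH 1?ltnW//.
by apply/esym/eqP; rewrite eq0.
Qed.

End TangentMeet.

(** * Grids *)

Section Grids.
Variables (R : realType) (n : nat).

Lemma knotE (xi : 'rV[R]_n.+1) (i : 'I_n.+1) : knot xi i = xi 0 i.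
Proof. by rewrite /knot inord_val. Qed.

Lemma is_gridP (l u : R) (xi : 'rV[R]_n.+1) :
  is_grid l u xi <-> [/\ knot xi 0 = l, knot xi n = u &
    forall i, (i < n)%N -> knot xi i < knot xi i.+1].
Proof.
rewrite /is_grid -!knotE; split=> -[-> -> inc]; split=> // i.
  by move=> lt_in; apply: inc; rewrite !inordK// ltnS ltnW.
move=> [j /= lt_jn] ij; rewrite -!knotE /=.
elim: j ij lt_jn => // j IH; rewrite ltnS leq_eqVlt => /predU1P[->|ij] lt_jn.
  exact: inc.
by apply: lt_trans (inc _ lt_jn); apply: IH => //; apply: ltnW.
Qed.

Lemma F_eq0 (p l u : R) (xi : 'rV[R]_n.+1) : 1 < p -> 0 <= l ->
  is_grid l u xi -> (F p xi = 0 <-> balanced R p n (knot xi)).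
Proof.
move=> p_gt1 l0 /is_gridP[xi0 _ inc].
have ge0 i : (i <= n)%N -> 0 <= knot xi i.
  case: i => [|i lt_in]; first by rewrite xi0.
  by apply/ltW/(incr_sequence_gt0 _ n); rewrite ?xi0.
have FE i : (i.+1 < n)%N -> Fcomp p xi i.+1 = p * (2 * knot xi i.+1 -
    (tangent_meet R p (knot xi i) (knot xi i.+1) +
     tangent_meet R p (knot xi i.+1) (knot xi i.+2))).
  move=> lt_in; have lt_i := ltnW lt_in.
  rewrite /Fcomp tangent_gap_divl ?tangent_gap_divr ?ge0 ?inc ?(ltnW lt_i)//=.
  by ring.
split=> [F0 i lt_in|bal].
  have lt_i : (i < n.-1)%N by lia.
  have := congr1 (fun A : 'cV[R]_n.-1 => A (Ordinal lt_i) 0) F0.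
  rewrite !mxE FE// => /eqP; rewrite mulf_eq0 gt_eqF ?(lt_trans ltr01)//=.
  by rewrite subr_eq0 => /eqP.
apply/matrixP => j k; rewrite !mxE FE; last by have := ltn_ord j; lia.
by rewrite bal ?subrr ?mulr0//; have := ltn_ord j; lia.
Qed.

End Grids.

Theorem theorem3p9 (R : realType) (l u p : R) (n : nat)
    (hl : 0 <= l) (hlu : l < u) (hn : (2 <= n)%N) (hp : 2 < p) :
  exists! xi : 'rV[R]_n.+1, is_grid l u xi /\ F p xi = 0.
Proof.
have p_gt1 : 1 < p by lra.
have n_gt0 : (0 < n)%N := ltnW hn.
have [x [xS x0 xn bx]] := exists_balanced_nondecreasing _ _ p_gt1 _ _ _ n_gt0 hl hlu.
have xlt : forall i, (i < n)%N -> x i < x i.+1.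
  by apply: balanced_incr p_gt1 _ _ _ _ xS bx; rewrite x0 ?xn.
pose xi : 'rV[R]_n.+1 := \row_i x i.
have knot_xi i : (i <= n)%N -> knot xi i = x i.
  by move=> le_in; rewrite /knot mxE inordK.
have grid_xi : is_grid l u xi.
  apply/is_gridP; rewrite !knot_xi//; split=> // i lt_in.
  by rewrite !knot_xi// ?xlt// ltnW.
exists xi; split.
  split=> //; apply/(F_eq0 _ _ _ _ _ _ p_gt1 hl grid_xi) => i lt_in.
  by rewrite !knot_xi ?bx// ltnW// ltnW.
move=> eta [grid_eta /(F_eq0 _ _ _ _ _ _ p_gt1 hl grid_eta) bal_eta].
have /is_gridP[eta0 etan etaS] := grid_eta.
apply/rowP => i; rewrite -[RHS]knotE mxE.
by apply: (balanced_eq _ _ p_gt1 _ _ _ _ _ hl x0 eta0 xn etan) => //; rewrite -ltnS.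
Qed.
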